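(* Let $Q,\widehat Q\in\mathbb{R}^{n\times n}$ be symmetric positive definite, let $r\in\mathbb{R}^n$, let $E_r$ and $\widehat E_r$ be the energies defined in the context, and let $\Delta_Q=\widehat Q-Q$. For any $z,z'\in\{0,1\}^n$, $$\left|\left[\widehat E_r(z)-\widehat E_r(z')\right]-\left[E_r(z)-E_r(z')\right]\right|\le\frac{\lVert\Delta_Q\rVert_2}{2}\lVert x_z-x_{z'}\rVert_2\lVert x_z+x_{z'}-2r\rVert_2.$$ Consequently, $z$ and $z'$ have the same strict order under $E_r$ and $\widehat E_r$ if $$|E_r(z)-E_r(z')|>\frac{\lVert\Delta_Q\rVert_2}{2}\lVert x_z-x_{z'}\rVert_2\lVert x_z+x_{z'}-2r\rVert_2.$$ Furthermore, $$\lVert x_z-x_{z'}\rVert_2=2\sqrt{d_{\mathrm H}(z,z')},$$ where $d_{\mathrm H}$ denotes the Hamming distance. Hence the right-hand side of the first inequality can be written as $\lVert\Delta_Q\rVert_2\sqrt{d_{\mathrm H}(z,z')}\,\lVert x_z+x_{z'}-2r\rVert_2$.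
   Context: $\lVert\cdot\rVert_2$ is the spectral norm for matrices and the Euclidean norm for vectors. For $r\in\mathbb{R}^n$: $y_i=0$ if $r_i\ge0$ and $y_i=1$ otherwise; $s_i=1-2y_i$. For $z\in\{0,1\}^n$, $x_z\in\{-1,+1\}^n$ is the column vector with components $s_i(1-2z_i)$. Define $$E_r(z)=\tfrac12(r-x_z)^{\mathsf T}Q(r-x_z),\qquad \widehat E_r(z)=\tfrac12(r-x_z)^{\mathsf T}\widehat Q(r-x_z).$$ ''Same strict order'' means that the differences of the two energies between $z$ and $z'$ are nonzero and have the same sign. *)

(* Defs.v *)
From mathcomp Require Import all_boot all_order all_algebra.
From mathcomp Require Import classical_sets reals.

Set Implicit Arguments.
Unset Strict Implicit.
Unset Printing Implicit Defensive.

Import Order.TTheory GRing.Theory Num.Theory.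

Local Open Scope ring_scope.
Local Open Scope classical_set_scope.

Section Norms.
Context {R : realType}.

Definition norm2 n (v : 'cV[R]_n) : R := Num.sqrt (\sum_(i < n) v i 0 ^+ 2).

(* The matrix norm induced by [norm2]. The set is nonempty (take v = 0) and
   bounded above (finite dimension), so that [sup] is its least upper bound. *)
Definition spectral_norm m n (A : 'M[R]_(m, n)) : R :=
  sup [set norm2 (A *m v) | v in [set v : 'cV[R]_n | norm2 v <= 1]].

Definition quad_form n (Q : 'M[R]_n) (v : 'cV[R]_n) : R := (v^T *m Q *m v) 0 0.

Definition sym_posdef n (Q : 'M[R]_n) : Prop :=
  Q^T = Q /\ (forall v : 'cV[R]_n, v != 0 -> 0 < quad_form Q v).

End Norms.

Section Energy.
Context {R : realType} {n : nat}.

Notation bits := {ffun 'I_n -> bool}.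

Definition sign_bits (r : 'cV[R]_n) : bits := [ffun i => ~~ (0 <= r i 0)].

Definition sign_of (r : 'cV[R]_n) (i : 'I_n) : R := 1 - 2 * (sign_bits r i)%:R.

Definition xvec (r : 'cV[R]_n) (z : bits) : 'cV[R]_n :=
  \col_i (sign_of r i * (1 - 2 * (z i)%:R)).

Definition energy (Q : 'M[R]_n) (r : 'cV[R]_n) (z : bits) : R :=
  2^-1 * quad_form Q (r - xvec r z).

Definition same_strict_order (E E' : bits -> R) (z z' : bits) : Prop :=
  [/\ E z - E z' != 0, E' z - E' z' != 0
    & Num.sg (E z - E z') = Num.sg (E' z - E' z')].

Definition hamming (z z' : bits) : nat := #|[set i | z i != z' i]%SET|.

End Energy.

(* Main.v *)
(** For symmetric D the difference of two values of the quadratic form v |-> v^T D v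
    factors as (v - w)^T D (v + w).  With D = Qhat - Q, v = x_z - r and w = x_z' - r,
    this and the Cauchy-Schwarz inequality give the perturbation bound; a gap
    in E exceeding the perturbation cannot change sign. *)
Require Import Defs.
From mathcomp Require Import all_boot all_order all_algebra.
From mathcomp Require Import ring lra.
From mathcomp Require Import reals.

Import Order.TTheory GRing.Theory Num.Theory.
Local Open Scope ring_scope.

(** Lagrange's identity: the sum of the squares [(u i * v j - u j * v i) ^+ 2] over all ordered
    pairs is twice the difference of the two sides, since each unordered pair is counted twice. *)
Lemma cauchy_schwarz_sum (R : realDomainType) (I : finType) (u v : I -> R) :
  (\sum_i u i * v i) ^+ 2 <= (\sum_i u i ^+ 2) * (\sum_i v i ^+ 2).
Proof.
have lagrange : \sum_i \sum_j (u i * v j - u j * v i) ^+ 2 =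
    ((\sum_i u i ^+ 2) * (\sum_i v i ^+ 2) - (\sum_i u i * v i) ^+ 2) *+ 2.
  transitivity (\sum_i \sum_j (u i ^+ 2 * v j ^+ 2) +
                \sum_i \sum_j (v i ^+ 2 * u j ^+ 2) -
                (\sum_i \sum_j ((u i * v i) * (u j * v j))) *+ 2).
    rewrite -sumrMnl -sumrN -!big_split /=; apply: eq_bigr => i _.
    rewrite -sumrMnl -sumrN -!big_split /=; apply: eq_bigr => j _; ring.
  by rewrite -!big_distrlr /=; ring.
rewrite -subr_ge0 -(@pmulrn_lge0 _ _ 2) // -lagrange.
by apply: sumr_ge0 => i _; apply: sumr_ge0 => j _; exact: sqr_ge0.
Qed.

Section Norms.
Context {R : realType}.

Lemma norm2_ge0 n (v : 'cV[R]_n) : 0 <= norm2 v.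
Proof. exact: sqrtr_ge0. Qed.

Lemma sqr_norm2 n (v : 'cV[R]_n) : norm2 v ^+ 2 = \sum_(i < n) v i 0 ^+ 2.
Proof. by rewrite sqr_sqrtr // sumr_ge0 // => i _; exact: sqr_ge0. Qed.

Lemma norm2Z n (a : R) (v : 'cV[R]_n) : norm2 (a *: v) = `|a| * norm2 v.
Proof.
rewrite /norm2 -sqrtr_sqr -sqrtrM ?sqr_ge0 // mulr_sumr.
by congr Num.sqrt; apply: eq_bigr => i _; rewrite mxE exprMn.
Qed.

Lemma cauchy_schwarz n (u v : 'cV[R]_n) :
  `|(u^T *m v) 0 0| <= norm2 u * norm2 v.
Proof.
rewrite -(@ler_pXn2r _ 2) ?nnegrE ?mulr_ge0 ?norm2_ge0 //.
rewrite real_normK ?num_real // exprMn !sqr_norm2 mxE.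
under eq_bigr do rewrite mxE.
exact: cauchy_schwarz_sum.
Qed.

(** Cauchy-Schwarz applied to each row of [A]. This crude bound shows that the set whose [sup]
    defines [spectral_norm] is bounded above. *)
Lemma norm2_mulmx_le_frobenius m n (A : 'M[R]_(m, n)) (v : 'cV[R]_n) :
  norm2 (A *m v) <= Num.sqrt (\sum_i \sum_j A i j ^+ 2) * norm2 v.
Proof.
have A2_ge0 : 0 <= \sum_i \sum_j A i j ^+ 2.
  by apply: sumr_ge0 => i _; apply: sumr_ge0 => j _; exact: sqr_ge0.
rewrite -(@ler_pXn2r _ 2) ?nnegrE ?mulr_ge0 ?norm2_ge0 ?sqrtr_ge0 //.
rewrite exprMn !sqr_norm2 sqr_sqrtr // mulr_suml.
apply: ler_sum => i _; rewrite mxE; exact: cauchy_schwarz_sum.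
Qed.

(** After rescaling [v] to norm 1, the norm of its image belongs to the set whose supremum is
    [spectral_norm A]. *)
Lemma norm2_mulmx_le_spectral_norm m n (A : 'M[R]_(m, n)) (v : 'cV[R]_n) :
  norm2 (A *m v) <= spectral_norm A * norm2 v.
Proof.
(* A vector of norm 0 cannot be rescaled; there the Frobenius bound already gives
   [norm2 (A *m v) <= 0]. *)
have [v0|v_neq0] := eqVneq (norm2 v) 0.
  by have := norm2_mulmx_le_frobenius _ _ A v; rewrite v0 !mulr0.
have v_gt0 : 0 < norm2 v by rewrite lt_neqAle eq_sym v_neq0 norm2_ge0.
rewrite -ler_pdivrMr // mulrC.
have -> : (norm2 v)^-1 * norm2 (A *m v) = norm2 (A *m ((norm2 v)^-1 *: v)).
  by rewrite -scalemxAr norm2Z gtr0_norm // invr_gt0.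
apply: ub_le_sup.
  exists (Num.sqrt (\sum_i \sum_j A i j ^+ 2)) => _ [w /= w_le1 <-].
  apply: le_trans (norm2_mulmx_le_frobenius _ _ A w) _.
  by rewrite ler_piMr ?sqrtr_ge0.
exists ((norm2 v)^-1 *: v) => //=.
by rewrite norm2Z gtr0_norm ?invr_gt0 // mulVf.
Qed.

Lemma quad_form_sub_sym n (D : 'M[R]_n) (v w : 'cV[R]_n) : D^T = D ->
  quad_form D v - quad_form D w = ((v - w)^T *m (D *m (v + w))) 0 0.
Proof.
move=> D_sym.
(* The two mixed terms are 1 by 1 matrices, transposes of each other because [D] is symmetric, so
   they cancel in the expanded product. *)
have cross : (w^T *m D *m v) 0 0 = (v^T *m D *m w) 0 0.
  have -> : w^T *m D *m v = (v^T *m D *m w)^T.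
    by rewrite !trmx_mul trmxK D_sym mulmxA.
  by rewrite mxE.
rewrite mulmxA linearB /= mulmxDr !mulmxBl /quad_form.
by move: cross; rewrite !mxE => ->; ring.
Qed.

Lemma quad_formB n (P Q : 'M[R]_n) (v : 'cV[R]_n) :
  quad_form (P - Q) v = quad_form P v - quad_form Q v.
Proof. by rewrite /quad_form mulmxBr mulmxBl !mxE. Qed.

Lemma quad_form_sub_le n (D : 'M[R]_n) (v w : 'cV[R]_n) : D^T = D ->
  `|quad_form D v - quad_form D w| <=
    spectral_norm D * norm2 (v - w) * norm2 (v + w).
Proof.
move=> /(quad_form_sub_sym n) ->; apply: le_trans (cauchy_schwarz _ _ _) _.
rewrite mulrAC [leRHS]mulrC ler_wpM2l ?norm2_ge0 //.
exact: norm2_mulmx_le_spectral_norm.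
Qed.

(** Whatever the sign at [i], the coordinates differ by 2 in absolute value if the bits differ and
    by 0 otherwise, so the squared norm is four times the Hamming distance. *)
Lemma norm2_sub_xvec n (r : 'cV[R]_n) (z z' : {ffun 'I_n -> bool}) :
  norm2 (xvec r z - xvec r z') = 2 * Num.sqrt (hamming z z')%:R.
Proof.
have -> : 2 * Num.sqrt (hamming z z')%:R =
    Num.sqrt (2 ^+ 2 * (hamming z z')%:R) :> R.
  by rewrite sqrtrM ?sqr_ge0 // sqrtr_sqr ger0_norm.
congr Num.sqrt; rewrite /hamming -sum1_card natr_sum mulr_sumr [RHS]big_mkcond /=.
apply: eq_bigr => i _; rewrite !mxE inE /sign_of.
by case: (sign_bits r i) (z i) (z' i) => [] [] [] /=; ring.
Qed.

End Norms.

(** A point closer to [a] than 0 is lies on the same side of 0 as [a]; for [a = 0] the hypothesis is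
    contradictory. *)
Lemma sg_eq_of_dist_lt (R : realDomainType) (a b : R) :
  `|b - a| < `|a| -> [/\ a != 0, b != 0 & Num.sg a = Num.sg b].
Proof.
have [->|a_gt0|a_lt0] := sgrP a; first by rewrite ltNge normr_ge0.
- rewrite ltr_norml => /andP[lb _]; have b_gt0 : 0 < b by lra.
  by rewrite gtr0_sg // !gt_eqF.
- rewrite ltr_norml => /andP[_ ub]; have b_lt0 : b < 0 by lra.
  by rewrite ltr0_sg // !lt_eqF.
Qed.

Theorem propositionB7 (R : realType) (n : nat) (Q Qhat : 'M[R]_n)
    (r : 'cV[R]_n) (hQ : sym_posdef Q) (hQhat : sym_posdef Qhat)
    (z z' : {ffun 'I_n -> bool}) :
  let DeltaQ := Qhat - Q in
  let E := energy Q r in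
  let Ehat := energy Qhat r in
  let x := xvec r in
  let bound := spectral_norm DeltaQ / 2 * norm2 (x z - x z')
                 * norm2 (x z + x z' - 2 *: r) in
  [/\ `|(Ehat z - Ehat z') - (E z - E z')| <= bound,
      `|E z - E z'| > bound -> same_strict_order E Ehat z z',
      norm2 (x z - x z') = 2 * Num.sqrt (hamming z z')%:R
    & bound = spectral_norm DeltaQ * Num.sqrt (hamming z z')%:R
                * norm2 (x z + x z' - 2 *: r)].
Proof.
move=> DeltaQ E Ehat x bound.
have Delta_sym : DeltaQ^T = DeltaQ.
  by case: hQ hQhat => [Qs _] [Qhs _]; rewrite linearB /= Qs Qhs.
have perturbation : `|(Ehat z - Ehat z') - (E z - E z')| <= bound.
  have -> : (Ehat z - Ehat z') - (E z - E z') =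
      2^-1 * (quad_form DeltaQ (x z - r) - quad_form DeltaQ (x z' - r)).
    (* Evenness of the form replaces [r - x z] by [x z - r], so that the sum of the two arguments is
       [x z + x z' - 2 *: r], as in [bound]. *)
    have qN P v : quad_form P (- v) = quad_form P v :> R.
      by rewrite /quad_form [(- v)^T]linearN /= mulNmx mulNmx mulmxN opprK.
    rewrite !quad_formB /E /Ehat /energy -/x -!(opprB (x _) r) !qN; ring.
  rewrite normrM ger0_norm ?invr_ge0 //.
  have := quad_form_sub_le n DeltaQ (x z - r) (x z' - r) Delta_sym.
  have -> : x z - r - (x z' - r) = x z - x z' by rewrite opprB addrA subrK.
  have -> : x z - r + (x z' - r) = x z + x z' - 2 *: r.
    by rewrite addrACA -opprD -mulr2n scaler_nat.
  rewrite /bound; lra.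
split=> //; [|exact: norm2_sub_xvec|].
- by move=> gap; apply: sg_eq_of_dist_lt; exact: le_lt_trans gap.
- by rewrite /bound norm2_sub_xvec; field.
Qed.
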